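(* Let $G$ be a finite connected graph and $\underline{d}$ a divisor on $G$ that is not effective. Consider the following procedure. Set $\underline{d}_0=\underline{d}$. For $i=0,1,2,\dots$: if $\underline{d}_i$ is effective, stop and output $\underline{d}_i$; otherwise let $N_i\subset V(G)$ be the (non-empty) set of vertices on which $\underline{d}_i$ has negative coefficients. If $N_i=V(G)$ or $W_{\mathrm{Dhar}}(\underline{d}_i,N_i)=\emptyset$, stop and output ''not effective''; otherwise set \[\underline{d}_{i+1}=\underline{d}_i+\mathrm{div}\bigl(\mathbb{1}_{W_{\mathrm{Dhar}}(\underline{d}_i,N_i)}\bigr)\] and continue with $i+1$. Then this procedure stops after finitely many steps. If it outputs a divisor $\underline{d}_i$, then $\underline{d}_i$ is an effective divisor linearly equivalent to $\underline{d}$; if it outputs ''not effective'', then $\underline{d}$ is not linearly equivalent to any effective divisor.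
   Context: $G$ is a finite connected vertex-weighted graph, multiple edges and loops allowed, with vertex set $V(G)$. A divisor is a formal sum $\underline{d}=\sum_{v\in V(G)}\underline{d}_v\, v$ with $\underline{d}_v\in\mathbb{Z}$. It is effective if $\underline{d}_v\ge 0$ for all $v$, and effective away from $V\subset V(G)$ if $\underline{d}_v\ge 0$ for all $v\notin V$. For $f:V(G)\to\mathbb{Z}$, $\mathrm{div}(f)$ is the divisor with $\mathrm{div}(f)_v=\sum_{e=vw}(f(w)-f(v))$, the sum over all edges $e$ adjacent to $v$ (loops contribute $0$). Two divisors are linearly equivalent if they differ by $\mathrm{div}(f)$ for some $f:V(G)\to\mathbb{Z}$. $\mathbb{1}_W$ denotes the characteristic function of $W\subset V(G)$. Dhar decomposition: let $V\subset V(G)$ be non-empty and $\underline{d}$ effective away from $V$. Define $V=V_0\subset V_1\subset\cdots$ by letting $V_{i+1}$ be the union of $V_i$ and the set of those vertices in $V(G)\setminus V_i$ on which $\underline{d}+\mathrm{div}(\mathbb{1}_{V(G)\setminus V_i})$ is negative. The sequence stabilizes at some $V_n=V_{n+1}$, and $W_{\mathrm{Dhar}}(\underline{d},V):=V(G)\setminus V_n$. *)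

(* Defs.v *)
From mathcomp Require Import all_boot all_order all_algebra.

Set Implicit Arguments.
Unset Strict Implicit.
Unset Printing Implicit Defensive.

Import Order.TTheory GRing.Theory Num.Theory.
Local Open Scope ring_scope.

(* Multiple edges and loops are allowed. The order of the two ends of an edge
   is only a presentation: [adjacent] and [div] below are invariant under
   swapping them. *)
Record wgraph := WGraph {
  vertex :> finType;
  edge : finType;
  ends : edge -> vertex * vertex;
  weight : vertex -> nat }.

Definition adjacent (G : wgraph) : rel G := fun u v =>
  [exists e : edge G, (ends e == (u, v)) || (ends e == (v, u))].

Definition connected (G : wgraph) : Prop :=
  (0 < #|G|)%N /\ forall u v : G, connect (@adjacent G) u v.

Definition divisor (G : wgraph) := {ffun G -> int}.

Definition effective (G : wgraph) (d : divisor G) : bool :=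
  [forall v, 0 <= d v].

Definition neg_support (G : wgraph) (d : divisor G) : {set G} :=
  [set v | d v < 0].

(* A non-loop edge vw is met exactly once from v, in one of the two sums; a
   loop is met in both, each time with contribution f v - f v = 0. *)
Definition div (G : wgraph) (f : G -> int) : divisor G :=
  [ffun v => \sum_(e : edge G | (ends e).1 == v) (f (ends e).2 - f v)
           + \sum_(e : edge G | (ends e).2 == v) (f (ends e).1 - f v)].

Definition lin_equiv (G : wgraph) (d d' : divisor G) : Prop :=
  exists f : G -> int, d' - d = div f.

Definition indicator (G : wgraph) (W : {set G}) : G -> int :=
  fun v => (v \in W)%:R.

Definition dhar_next (G : wgraph) (d : divisor G) (U : {set G}) : {set G} :=
  U :|: [set v in ~: U | (d + div (indicator (~: U))) v < 0].

Definition dhar_seq (G : wgraph) (d : divisor G) (V : {set G}) (i : nat) :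
    {set G} :=
  iter i (dhar_next d) V.

Lemma dhar_stabilizes (G : wgraph) (d : divisor G) (V : {set G}) :
  exists n, dhar_seq d V n == dhar_seq d V n.+1.
Proof.
suff grow n : (exists m, dhar_seq d V m == dhar_seq d V m.+1) \/
    (n <= #|dhar_seq d V n|)%N.
  by case: (grow #|G|.+1) => // /leq_trans/(_ (max_card _)); rewrite ltnn.
elim: n => [|n [|IHn]]; [by right | by left |].
have [eqV|neV] := boolP (dhar_seq d V n == dhar_seq d V n.+1).
  by left; exists n.
right; apply: leq_ltn_trans IHn _; apply: proper_card.
by rewrite properEneq neV subsetUl.
Qed.

(* Total in V and d; meaningful when V is non-empty and d is effective away
   from V. *)
Definition W_Dhar (G : wgraph) (d : divisor G) (V : {set G}) : {set G} :=
  ~: dhar_seq d V (ex_minn (dhar_stabilizes d V)).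

Inductive output (G : wgraph) :=
  | OutDivisor of divisor G
  | OutNotEffective.

Arguments OutNotEffective {G}.

(* [inl d'] means "continue with d'", [inr o] means "stop and output o". *)
Definition proc_step (G : wgraph) (d : divisor G) : divisor G + output G :=
  if effective d then inr (OutDivisor d) else
  let N := neg_support d in
  let W := W_Dhar d N in
  if (N == setT) || (W == set0) then inr OutNotEffective
  else inl (d + div (indicator W)).

(* [proc_run n d] is the output of the procedure started at d if it stops at
   some index i <= n, and [None] if it has not stopped by then. *)
Fixpoint proc_run (G : wgraph) (n : nat) (d : divisor G) : option (output G) :=
  match proc_step d with
  | inr o => Some o
  | inl d' => if n is m.+1 then proc_run m d' else None
  end.

Definition proc_outputs (G : wgraph) (d : divisor G) (o : output G) : Prop :=
  exists n, proc_run n d = Some o.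

(* Main.v *)
(** Firing a set [W] disjoint from the negative vertices adds [div (indicator W)].
    If [d + div f] is effective, the set where [f] is maximal survives Dhar's
    burning: it avoids every set of the Dhar sequence, since a vertex of it that
    burns would already be negative in [d + div f].  So an empty [W_Dhar] rules
    out effective divisors in the class.

    For termination, the negative support [N] can only shrink.  While it stays the
    same, take a function [h >= 0] vanishing on [N] with [div h < 0] off [N], which
    exists by connectedness.  As [div] is self-adjoint, a firing changes
    [\sum_v d v * h v] by [\sum_(v in W) div h v < 0], whereas this sum remains
    non-negative because [h] kills the negative coefficients. *)

Require Import Defs.
From mathcomp Require Import all_boot all_order all_algebra.
From mathcomp Require Import zify.

Set Implicit Arguments.
Unset Strict Implicit.
Unset Printing Implicit Defensive.

Import Order.TTheory GRing.Theory Num.Theory.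
Local Open Scope ring_scope.

(** * The Laplacian: comparison, self-adjointness, strictly superharmonic functions *)

Section Laplacian.
Variable G : wgraph.
Implicit Types (f g h : G -> int) (U W : {set G}) (u v w : G).

Lemma divD f g : div (fun v => f v + g v) = div f + div g.
Proof.
apply/ffunP=> v; rewrite !ffunE addrACA -!big_split /=.
by congr (_ + _); apply: eq_bigr => e _; rewrite opprD addrACA.
Qed.

Lemma divZ (k : int) f v : div (fun u => k * f u) v = k * div f v.
Proof.
rewrite !ffunE mulrDr !mulr_sumr.
by congr (_ + _); apply: eq_bigr => e _; rewrite mulrBr.
Qed.

Lemma div_cst (c : int) : div (fun _ : G => c) = 0.
Proof.
by apply/ffunP=> v; rewrite !ffunE !big1 ?addr0 // => e _; rewrite subrr.
Qed.

Lemma ler_div f g v :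
  (forall u, f u - f v <= g u - g v) -> div f v <= div g v.
Proof. by move=> le_fg; rewrite !ffunE lerD // ler_sum. Qed.

Lemma ltr_div f g v w : adjacent v w ->
  (forall u, f u - f v <= g u - g v) -> f w - f v < g w - g v ->
  div f v < div g v.
Proof.
move=> /existsP[e /orP[]/eqP De] le_fg lt_fg; rewrite !ffunE.
  apply: ltr_leD; last exact: ler_sum.
  rewrite (bigD1 e) ?De //= [ltRHS](bigD1 e) ?De //=.
  by apply: ltr_leD => //; apply: ler_sum.
apply: ler_ltD; first exact: ler_sum.
rewrite (bigD1 e) ?De //= [ltRHS](bigD1 e) ?De //=.
by apply: ltr_leD => //; apply: ler_sum.
Qed.

(** Summation by parts: each edge contributes once from each of its two ends. The right-hand side is
    symmetric in [f] and [g], whence self-adjointness. *)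
Lemma sum_divM f g :
  \sum_v div f v * g v =
  - \sum_(e : edge G) (f (ends e).2 - f (ends e).1)
                      * (g (ends e).2 - g (ends e).1).
Proof.
have E (p : edge G -> G) (F : edge G -> G -> int) :
    \sum_v (\sum_(e | p e == v) F e v) * g v = \sum_e F e (p e) * g (p e).
  rewrite [RHS](partition_big p xpredT) //=; apply: eq_bigr => v _.
  by rewrite mulr_suml; apply: eq_bigr => e /eqP->.
under eq_bigr do rewrite ffunE mulrDl.
rewrite big_split /= !E -big_split -sumrN; apply: eq_bigr => e _ /=.
nia.
Qed.

Lemma div_selfadjoint f g : \sum_v div f v * g v = \sum_v f v * div g v.
Proof.
under [RHS]eq_bigr do rewrite mulrC.
by rewrite !sum_divM; congr (- _); apply: eq_bigr => e _; rewrite mulrC.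
Qed.

Lemma div_indicator_le0 W v : v \in W -> div (indicator W) v <= 0.
Proof.
move=> vW; have <- : div (fun _ : G => 0) v = 0 by rewrite div_cst ffunE.
by apply: ler_div => u; rewrite /indicator vW; case: (u \in W).
Qed.

Lemma div_indicator_ge0 W v : v \notin W -> 0 <= div (indicator W) v.
Proof.
move=> /negPf vW; have <- : div (fun _ : G => 0) v = 0 by rewrite div_cst ffunE.
by apply: ler_div => u; rewrite /indicator vW; case: (u \in W).
Qed.

Lemma div_indicator_lt0 W v w :
  v \in W -> w \notin W -> adjacent v w -> div (indicator W) v < 0.
Proof.
move=> vW /negPf wW vw.
have <- : div (fun _ : G => 0) v = 0 by rewrite div_cst ffunE.
apply: (ltr_div vw); last by rewrite /indicator vW wW.
by move=> u; rewrite /indicator vW; case: (u \in W).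
Qed.

Lemma adjacent_sym u v : adjacent u v = adjacent v u.
Proof. by apply: eq_existsb => e; rewrite orbC. Qed.

(** Without a crossing edge, [U] would be closed under adjacency, hence everything. *)
Lemma connected_boundary U : connected G -> U != set0 -> U != setT ->
  exists v w, [/\ v \notin U, w \in U & adjacent v w].
Proof.
move=> [_ conn] /set0Pn[x xU] /eqP UT.
have [/existsP[v /existsP[w /and3P[]]]|] :=
    boolP [exists v, exists w, [&& v \notin U, w \in U & adjacent v w]].
  by move=> *; exists v, w.
move=> /existsPn noedge; case: UT; apply/setP=> y; rewrite inE.
have clU : closed (@adjacent G) (mem U).
  move=> a b ab /=; have /existsPn/(_ b) := noedge a.
  have /existsPn/(_ a) := noedge b; rewrite [adjacent b a]adjacent_sym ab !andbT.
  by case: (a \in U); case: (b \in U).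
by rewrite -(closed_connect clU (conn x y)).
Qed.

(* [U] collects the vertices off [N] where [div h < 0] already holds; a large
   multiple of [h] keeps this after adding the indicator of the complement of
   [U], which makes [div] negative at the vertices just outside [U]. *)
Lemma superharmonic_extension (N U : {set G}) h : connected G ->
  N != set0 -> N \subset U -> (forall v, 0 <= h v) ->
  {in N, forall v, h v = 0} -> (forall v, v \notin N -> div h v <= 0) ->
  {in U :\: N, forall v, div h v < 0} ->
  exists g, [/\ forall v, 0 <= g v, {in N, forall v, g v = 0} &
    forall v, v \notin N -> div g v < 0].
Proof.
move=> conn N0; have [n] := ubnP #|~: U|; elim: n U h => // n IHn U h ltUn.
move=> sNU h0 hN hsup hU; have [UT|neU] := eqVneq U setT.
  by exists h; split=> // v vN; apply: hU; rewrite UT !inE vN.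
have U0 : U != set0 by apply: contraNneq N0 => U0; rewrite -subset0 -U0.
have [u [w [uU wU uw]]] := connected_boundary conn U0 neU.
(* [K] exceeds every value of [div c], so wherever the integer [div h v] is at most -1,
   [K * div h v + div c v] is negative. *)
pose c := indicator (~: U); pose K : int := 1 + \sum_v `|div c v|.
have ltK v : div c v < K.
  rewrite /K (bigD1 v) //=; apply: (le_lt_trans (ler_norm _)).
  by rewrite addrCA ltrDl ltr_pwDl // sumr_ge0.
have K0 : 0 <= K by rewrite addr_ge0 // sumr_ge0.
have divE v : div (fun v => K * h v + c v) v = K * div h v + div c v.
  by rewrite divD ffunE divZ.
have ltU v : v \in U :\: N -> K * div h v + div c v < 0.
  by move=> /hU; have := ltK v; nia.
apply: (IHn (u |: U) (fun v => K * h v + c v)).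
- rewrite -ltnS; apply: leq_trans ltUn; rewrite ltnS; apply: proper_card.
  by rewrite setCU; apply/properP; split; [exact: subsetIr | exists u; rewrite !inE ?eqxx].
- by rewrite (subset_trans sNU) // subsetUr.
- by move=> v; rewrite addr_ge0 ?mulr_ge0 ?/c ?/indicator //; case: (v \in _).
- by move=> v vN; rewrite hN // mulr0 /c /indicator inE (subsetP sNU).
- move=> v vN; rewrite divE; have [vU|vU] := boolP (v \in U).
    by apply/ltW/ltU; rewrite inE vN.
  have vUC : v \in ~: U by rewrite inE.
  by have := div_indicator_le0 vUC; have := hsup v vN; rewrite -/c; nia.
- move=> v; rewrite divE !inE => /andP[vN /orP[/eqP vu|vU]]; last first.
    by apply: ltU; rewrite inE vN.
  (* At [u] the strict sign comes from [c], which drops from 1 to 0 along the edge to [w]. *)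
  rewrite vu in vN *; apply: ltr_wnDl; first by rewrite mulr_ge0_le0 ?hsup.
  by apply: div_indicator_lt0 uw; rewrite inE // negbK.
Qed.

(** The extension starts from [U = N] and [h = 0], where strictness on [U :\: N] is vacuous. *)
Lemma strict_superharmonic_exists (N : {set G}) : connected G -> N != set0 ->
  exists h, [/\ forall v, 0 <= h v, {in N, forall v, h v = 0} &
    forall v, v \notin N -> div h v < 0].
Proof.
move=> conn N0; apply: (superharmonic_extension (U := N) (h := fun=> 0)) => //.
  by move=> v _; rewrite div_cst ffunE.
by move=> v; rewrite setDv inE.
Qed.

End Laplacian.

(** * Dhar's burning set *)

Section Dhar.
Variable G : wgraph.
Implicit Types (d : divisor G) (f : G -> int) (V W : {set G}).

Lemma W_Dhar_disjoint d V v : v \in W_Dhar d V -> v \notin V.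
Proof.
rewrite inE; apply: contra => vV.
by elim: (ex_minn _) => //= n IHn; rewrite inE IHn.
Qed.

(** A vertex violating this would burn at the next step, but the sequence is already stable. *)
Lemma W_Dhar_fire_ge0 d V v :
  v \in W_Dhar d V -> 0 <= (d + div (indicator (W_Dhar d V))) v.
Proof.
rewrite /W_Dhar; case: ex_minnP => n /eqP eqn _; rewrite inE => vV.
rewrite leNgt; apply: contra (vV) => neg; rewrite eqn /= !inE vV /=.
by apply/orP; right.
Qed.

Lemma W_Dhar_neq0 d f : effective (d + div f) -> (0 < #|G|)%N ->
  W_Dhar d (neg_support d) != set0.
Proof.
move=> /forallP eff /card_gt0P[x0 _].
have [m _ maxm] := Order.TotalTheory.arg_maxP f (isT : xpredT x0).
pose A := [set v | f v == f m].
suff AC n : [disjoint A & dhar_seq d (neg_support d) n].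
  have mA : m \in A by rewrite inE.
  by apply/set0Pn; exists m; rewrite inE (disjointFr (AC _) mA).
(* From a maximum of the integer-valued [f], the drop is at least 1 outside [A], hence on [U]. So
   [f] falls at least as much as the indicator of [~: U], and [div f v] is at most the [div] of that
   indicator. *)
have below (U : {set G}) v : [disjoint A & U] -> v \in A ->
    0 <= (d + div (indicator (~: U))) v.
  move=> AU vA; have := eff v; rewrite !ffunE -/(div _).
  move=> /le_trans; apply; rewrite lerD2l.
  have := @ler_div G f (indicator (~: U)) v; rewrite !ffunE; apply=> u.
  have := vA; rewrite inE => /eqP->; rewrite /indicator !inE (disjointFr AU vA).
  have [uA|] := boolP (u \in A).
    by rewrite (disjointFr AU uA); move: uA; rewrite inE => /eqP->; rewrite !subrr.
  rewrite inE => neq; have : f u < f m by rewrite lt_neqAle neq; exact: (maxm u isT).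
  by case: (u \in U) => /=; lia.
elim: n => [|n IHn] /=; rewrite -setI_eq0; apply/set0Pn => -[v].
  rewrite !in_setI => /andP[vA]; rewrite inE => neg.
  (* Base case: taking [U] empty in [below] shows that [d] is non-negative on [A]. *)
  have A0 : [disjoint A & set0 : {set G}] by rewrite -setI_eq0 setI0.
  have := below set0 v A0 vA; rewrite setC0 ffunE leNgt ltr_wnDr //.
  exact: div_indicator_le0.
rewrite in_setI => /andP[vA]; rewrite !inE (disjointFr IHn vA) /=.
by rewrite ltNge (below _ _ IHn vA).
Qed.

(** Fired vertices end non-negative; all other coefficients can only grow. *)
Lemma neg_support_fire d : neg_support
  (d + div (indicator (W_Dhar d (neg_support d)))) \subset neg_support d.
Proof.
set W := W_Dhar _ _; apply/subsetP=> v; rewrite !inE => neg.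
have [vW|vW] := boolP (v \in W).
  by move: neg; rewrite ltNge W_Dhar_fire_ge0.
by apply: le_lt_trans neg; rewrite ffunE lerDl div_indicator_ge0.
Qed.

End Dhar.

(** * Correctness and termination of the procedure *)

Section Procedure.
Variable G : wgraph.
Implicit Types (d : divisor G) (o : output G).

Lemma proc_outputs_stop d o : proc_step d = inr o -> proc_outputs d o.
Proof. by move=> E; exists 0%N; rewrite /= E. Qed.

Lemma proc_outputs_step d d' o :
  proc_step d = inl d' -> proc_outputs d' o -> proc_outputs d o.
Proof. by move=> E [n run]; exists n.+1; rewrite /= E. Qed.

(** Induction along a run, which hides the step bound of [proc_run]. *)
Lemma proc_outputs_ind (P : divisor G -> output G -> Prop) :
  (forall d o, proc_step d = inr o -> P d o) ->
  (forall d d' o, proc_step d = inl d' -> P d' o -> P d o) ->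
  forall d o, proc_outputs d o -> P d o.
Proof.
move=> Pstop Pstep d o [n]; elim: n d => [|n IHn] d /=.
  by case E: (proc_step d) => [//|o'] [<-]; apply: Pstop.
case E: (proc_step d) => [d'|o']; first by move/IHn; apply: Pstep E.
by move=> [<-]; apply: Pstop.
Qed.

Lemma lin_equiv_refl d : lin_equiv d d.
Proof. by exists (fun=> 0); rewrite div_cst subrr. Qed.

Lemma lin_equiv_trans d2 d1 d3 :
  lin_equiv d1 d2 -> lin_equiv d2 d3 -> lin_equiv d1 d3.
Proof.
move=> [f Ef] [g Eg]; exists (fun v => g v + f v).
by rewrite divD -Ef -Eg addrA subrK.
Qed.

Lemma lin_equiv_sym d1 d2 : lin_equiv d1 d2 -> lin_equiv d2 d1.
Proof.
move=> [f Ef]; exists (fun v => -1 * f v).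
by apply/ffunP=> v; rewrite divZ -Ef !ffunE mulN1r opprB.
Qed.

Variant proc_step_spec d : divisor G + output G -> Prop :=
  | ProcDone of effective d : proc_step_spec d (inr (OutDivisor d))
  | ProcFail of ~~ effective d
      & neg_support d = setT \/ W_Dhar d (neg_support d) = set0 :
      proc_step_spec d (inr OutNotEffective)
  | ProcFire of ~~ effective d & W_Dhar d (neg_support d) != set0 :
      proc_step_spec d
        (inl (d + div (indicator (W_Dhar d (neg_support d))))).

Lemma proc_stepP d : proc_step_spec d (proc_step d).
Proof.
rewrite /proc_step; case: ifPn => [|neff]; first exact: ProcDone.
case: ifPn => [/orP[]/eqP NW|/norP[_ W0]]; last exact: ProcFire.
  by apply: ProcFail => //; left.
by apply: ProcFail => //; right.
Qed.

Lemma proc_step_lin_equiv d d' : proc_step d = inl d' -> lin_equiv d d'.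
Proof.
case: proc_stepP => // _ _ [<-]; exists (indicator (W_Dhar d (neg_support d))).
by rewrite addrAC subrr add0r.
Qed.

Lemma proc_outputs_effective d d' : proc_outputs d (OutDivisor d') ->
  effective d' /\ lin_equiv d d'.
Proof.
pose P d o := if o is OutDivisor e then effective e /\ lin_equiv d e else True.
apply: (proc_outputs_ind (P := P)) => {d d'} [d o|d d1 [e|] //= E [eff Le]].
  by case: proc_stepP => // [eff|_ _] [<-] //; split=> //; apply: lin_equiv_refl.
by split=> //; apply: lin_equiv_trans (proc_step_lin_equiv E) Le.
Qed.

Lemma proc_outputs_not_effective d : (0 < #|G|)%N ->
  proc_outputs d OutNotEffective ->
  ~ exists d', effective d' /\ lin_equiv d d'.
Proof.
move=> G0.
pose P d o := if o is OutDivisor _ then True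
              else ~ exists d', effective d' /\ lin_equiv d d'.
apply: (proc_outputs_ind (P := P)) => {d} [d o|d d1 [//|] /= E nex].
  case: proc_stepP => // [_ [<-] //|_ NW [<-] [d' [eff [f Ef]]]].
  have /(W_Dhar_neq0 (f := f))/(_ G0) : effective (d + div f).
    by rewrite -Ef addrC subrK.
  (* If every coefficient is negative, the Dhar set is again empty, being disjoint from the negative
     support. *)
  case: NW => [NT|->]; last by rewrite eqxx.
  by case/set0Pn=> v /W_Dhar_disjoint; rewrite NT inE.
case=> d' [eff Ld']; apply: nex; exists d'; split=> //.
exact: lin_equiv_trans (lin_equiv_sym (proc_step_lin_equiv E)) Ld'.
Qed.

Lemma sum_fire_lt d (W : {set G}) (h : G -> int) : W != set0 ->
  {in W, forall v, div h v < 0} ->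
  \sum_v (d + div (indicator W)) v * h v < \sum_v d v * h v.
Proof.
move=> /set0Pn[w wW] hW.
under eq_bigr do rewrite ffunE mulrDl.
rewrite big_split /= gtrDl div_selfadjoint (bigD1 w) //= {1}/indicator wW mul1r.
apply: ltr_wnDr; last exact: hW.
apply: sumr_le0 => v _; rewrite /indicator.
by case: (boolP (v \in W)) => [/hW/ltW|_]; rewrite ?mul1r ?mul0r.
Qed.

Lemma proc_terminates d : connected G -> exists o, proc_outputs d o.
Proof.
move=> conn; have [n] := ubnP #|neg_support d|; elim: n d => // n IHn d ltdn.
have [N0|N0] := eqVneq (neg_support d) set0.
  have eff : effective d.
    by apply/forallP=> v; have := in_set0 v; rewrite -N0 inE ltNge => /negbFE.
  by exists (OutDivisor d); apply: proc_outputs_stop; rewrite /proc_step eff.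
have [h [h0 hN hlt]] := strict_superharmonic_exists conn N0.
(* Naming the support [N] keeps [h] fixed while [d] varies in the inner induction. *)
move: N0 ltdn hN hlt; move EN: (neg_support d) => N N0 ltNn hN hlt.
have Psi0 e : neg_support e = N -> 0 <= \sum_v e v * h v.
  move=> Ee; apply: sumr_ge0 => v _; have [vN|] := boolP (v \in N).
    by rewrite hN ?mulr0.
  by rewrite -Ee inE -leNgt => e0; rewrite mulr_ge0.
(* Inner induction on a strict upper bound [m] of the potential; [m = 0] contradicts [Psi0]. *)
have [m ltm] : exists m : nat, \sum_v d v * h v < m%:Z.
  by case: (\sum_v d v * h v) => k; [exists k.+1; rewrite ltz_nat | exists 0%N].
elim: m d EN ltm => [|m IHm] d EN ltm.
  by have := Psi0 d EN; rewrite leNgt ltm.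
case E: (proc_step d) => [d'|o]; last by exists o; apply: proc_outputs_stop.
suff [o run] : exists o, proc_outputs d' o.
  by exists o; apply: proc_outputs_step run.
move: E; case: proc_stepP => // _ W0 [<-].
have sub := neg_support_fire d; rewrite EN in sub W0 *.
(* With the same support, the integer potential drops by at least 1, so the bound [m] suffices;
   otherwise the support is strictly smaller and the outer induction applies. *)
set e := d + _ in sub *; have [Ee|neN] := eqVneq (neg_support e) N.
  apply: IHm => //; have : \sum_v e v * h v < \sum_v d v * h v.
    by apply: sum_fire_lt => // v /W_Dhar_disjoint/hlt.
  by move/lt_le_trans; apply; rewrite -ltzD1 addrC -intS.
apply: IHn; rewrite (leq_trans _ (ltNn : #|N| <= n)%N) //.
by apply: proper_card; rewrite properEneq neN sub.
Qed.

End Procedure.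

Theorem mainTheorem4 (G : wgraph) (d : divisor G)
    (hG : connected G) (hd : ~~ effective d) :
  [/\ exists o : output G, proc_outputs d o,
      forall d' : divisor G, proc_outputs d (OutDivisor d') ->
        effective d' /\ lin_equiv d d'
    & proc_outputs d OutNotEffective ->
        ~ exists d' : divisor G, effective d' /\ lin_equiv d d'].
Proof.
split; first exact: proc_terminates.
  by move=> d'; apply: proc_outputs_effective.
by apply: proc_outputs_not_effective; case: hG.
Qed.
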